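(* The category $\mathbf{SkeZLC}$ of all zero-dimensional locally compact Hausdorff spaces and all continuous skeletal maps between them is dually equivalent to the category $\mathbf{SkeZLBA}$, whose objects are all ZLB-algebras and whose morphisms are all $\mathbf{ZLBA}$-morphisms $\varphi:(A,I)\to(B,J)$ such that $\varphi:A\to B$ is a complete Boolean homomorphism.
   Context: A space is zero-dimensional if its clopen subsets form a base. A map $f:X\to Y$ is skeletal if $\mathrm{int}(f^{-1}(\mathrm{cl}(V)))\subseteq \mathrm{cl}(f^{-1}(V))$ for every open $V\subseteq Y$ (equivalently, $\mathrm{int}(\mathrm{cl}(f(U)))\neq\emptyset$ for every non-empty open $U\subseteq X$). For a distributive $\{0\}$-pseudolattice $I$ (a poset with least element $0$ and all finite non-empty meets and joins, distributive), $Idl(I)$ is the frame of all ideals of $I$; for $J\in Idl(I)$, $\neg J=\{a\in I : a\wedge b=0\ \text{for all } b\in J\}$. The ideal $J$ is simple if $J\vee\neg J=I$ in $Idl(I)$; $Si(I)$ is the set of simple ideals. A local Boolean algebra (LBA) is a pair $(A,I)$, where $A$ is a Boolean algebra and $I$ is an ideal of $A$ (possibly non-proper) which is dense in $A$, i.e. for every $a\in A\setminus\{0\}$ there is $b\in I\setminus\{0\}$ with $b\le a$. An LBA $(B,I)$ is a ZLB-algebra (ZLBA) if for every $J\in Si(I)$ the join $\bigvee_B J$ exists in $B$. The category $\mathbf{ZLBA}$ has ZLBAs as objects; its morphisms $\varphi:(A,I)\to(B,J)$ are the Boolean homomorphisms $\varphi:A\to B$ such that for every $b\in J$ there exists $a\in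 I$ with $b\le\varphi(a)$; composition is the usual composition of functions. A Boolean homomorphism $\varphi$ is complete if it preserves all joins that happen to exist: if a family $\{a_i\}$ in the domain has join $a$, then $\{\varphi(a_i)\}$ has a join and this join is $\varphi(a)$. Two categories are dually equivalent if one is equivalent to the opposite of the other. *)

(* Defs.v *)
From mathcomp Require Import all_boot all_order.
From mathcomp Require Import all_classical.
From mathcomp Require Import topology.

Set Implicit Arguments.
Unset Strict Implicit.
Unset Printing Implicit Defensive.

Import Order.Theory.

Local Open Scope classical_set_scope.

Record category := Category {
  obj :> Type;
  hom : obj -> obj -> Type;
  idc : forall X, hom X X;
  comp : forall X Y Z, hom Y Z -> hom X Y -> hom X Z;
  comp_idl : forall X Y (f : hom X Y), comp (idc Y) f = f;
  comp_idr : forall X Y (f : hom X Y), comp f (idc X) = f;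
  compA : forall X Y Z W (h : hom Z W) (g : hom Y Z) (f : hom X Y),
    comp h (comp g f) = comp (comp h g) f }.

Definition opposite (C : category) : category :=
  @Category C (fun X Y => hom Y X) (@idc C) (fun X Y Z g f => comp f g)
    (fun X Y f => comp_idr f) (fun X Y f => comp_idl f)
    (fun X Y Z W h g f => esym (compA f g h)).

Record cat_functor (C D : category) := CatFunctor {
  fobj :> C -> D;
  fmap : forall X Y, hom X Y -> hom (fobj X) (fobj Y);
  fmap_id : forall X, fmap (idc X) = idc (fobj X);
  fmap_comp : forall X Y Z (g : hom Y Z) (f : hom X Y),
    fmap (comp g f) = comp (fmap g) (fmap f) }.

Definition id_functor (C : category) : cat_functor C C :=
  @CatFunctor C C id (fun X Y f => f) (fun X => erefl) (fun X Y Z g f => erefl).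

Definition comp_functor (C D E : category) (G : cat_functor D E)
    (F : cat_functor C D) : cat_functor C E :=
  @CatFunctor C E (fun X => G (F X)) (fun X Y f => fmap G (fmap F f))
    (fun X => etrans (congr1 (@fmap _ _ G _ _) (fmap_id F X)) (fmap_id G (F X)))
    (fun X Y Z g f => etrans (congr1 (@fmap _ _ G _ _) (fmap_comp F g f))
                             (fmap_comp G (fmap F g) (fmap F f))).

Definition is_iso (C : category) (X Y : C) (f : hom X Y) : Prop :=
  exists g : hom Y X, comp g f = idc X /\ comp f g = idc Y.

Definition naturally_isomorphic (C D : category) (F G : cat_functor C D) : Prop :=
  exists eta : forall X, hom (F X) (G X),
    (forall X, is_iso (eta X)) /\
    (forall X Y (f : hom X Y), comp (fmap G f) (eta X) = comp (eta Y) (fmap F f)).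

Definition equivalent (C D : category) : Prop :=
  exists (F : cat_functor C D) (G : cat_functor D C),
    naturally_isomorphic (comp_functor G F) (id_functor C) /\
    naturally_isomorphic (comp_functor F G) (id_functor D).

Definition dually_equivalent (C D : category) : Prop :=
  equivalent C (opposite D).

(* The library's [zero_dimensional] only asks that distinct points be          *)
(* separated by a clopen set, which is weaker than having a clopen base.      *)
Definition clopen_base (X : topologicalType) : Prop := basis (@clopen X).

Definition skeletal (X Y : topologicalType) (f : X -> Y) : Prop :=
  forall V : set Y, open V ->
    (f @^-1` closure V)° `<=` closure (f @^-1` V).

Lemma skeletal_id (X : topologicalType) : skeletal (@idfun X).
Proof. by move=> V _; exact: interior_subset. Qed.

Lemma skeletal_comp (X Y Z : topologicalType) (g : Y -> Z) (f : X -> Y) :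
  continuous f -> continuous g -> skeletal f -> skeletal g ->
  skeletal (g \o f).
Proof.
move=> cf cg sf sg V oV x Ox.
pose C := g @^-1` closure V; pose D := C° `|` ~` C.
have clC : closed C.
  by apply: preimage_closed => //; exact: closed_closure.
have oW : open (g @^-1` V) by apply: open_comp => // y _; exact: cg.
have oD : open D by apply: openU; [exact: open_interior | exact: closed_openC].
have dD y : closure D y.
  move=> B /nbhs_interior By.
  have [sBC|/existsNP[z /not_implyP[Bz nCz]]] := pselect (B° `<=` C).
    exists y; split; last exact: interior_subset (nbhs_singleton By).
    by left; apply: filterS By.
  by exists z; split; [right | exact: interior_subset].
have clfD : closure (f @^-1` D) x.
  apply: (sf _ oD); apply: (@filterS _ (nbhs x) _ setT) => [y _|].
    exact: dD.
  exact: filterT.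
have fCW : f @^-1` C° `<=` closure (f @^-1` (g @^-1` V)).
  apply: subset_trans (sf _ oW).
  have oC : open (f @^-1` C°).
    by apply: open_comp => [y _|]; [exact: cf | exact: open_interior].
  by rewrite -open_subsetE //; apply: preimage_subset; exact: sg.
rewrite comp_preimage.
have : closure (closure (f @^-1` (g @^-1` V))) x.
  move=> B Bx.
  have [z [Dz [Oz Bz]]] := clfD _ (filterI (nbhs_interior Ox) Bx).
  exists z; split => //; apply: fCW.
  by case: Dz => // nC; case: nC; exact: interior_subset Oz.
by rewrite -(closure_id _).1 //; exact: closed_closure.
Qed.

Record zlc_space := ZLCSpace {
  zlc_top :> topologicalType;
  zlc_hausdorff : hausdorff_space zlc_top;
  zlc_locally_compact : locally_compact [set: zlc_top];
  zlc_clopen_base : clopen_base zlc_top }.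

Definition skezlc_hom (X Y : zlc_space) : Type :=
  {f : X -> Y | continuous f /\ skeletal f}.

Program Definition skezlc_id (X : zlc_space) : skezlc_hom X X :=
  exist _ idfun _.
Next Obligation. by move=> X; split; [move=> x|exact: skeletal_id]. Qed.

Program Definition skezlc_comp (X Y Z : zlc_space) (g : skezlc_hom Y Z)
    (f : skezlc_hom X Y) : skezlc_hom X Z :=
  exist _ (sval g \o sval f) _.
Next Obligation.
move=> X Y Z [g [cg sg]] [f [cf sf]] /=; split; last exact: skeletal_comp.
by move=> x; apply: continuous_comp; [exact: cf | exact: cg].
Qed.

Program Definition SkeZLC : category :=
  @Category zlc_space skezlc_hom skezlc_id skezlc_comp _ _ _.
Next Obligation. by move=> X Y [f Hf]; exact: eq_exist. Qed.
Next Obligation. by move=> X Y [f Hf]; exact: eq_exist. Qed.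
Next Obligation. by move=> X Y Z W h g f; exact: eq_exist. Qed.

Section Ideals.
Context {d : Order.disp_t} {L : bDistrLatticeType d}.
Implicit Types I J : set L.

(* [ideal_of I J]: J is an ideal of the {0}-pseudolattice I, where I is setT  *)
(* or an ideal of L, so that \bot and the meets and joins of I are those of L.*)
(* An ideal of I is represented by its underlying subset of L.                *)
Definition ideal_of I J : Prop :=
  [/\ J `<=` I,
      J \bot%O,
      (forall a b, J a -> J b -> J (a `|` b)%O) &
      (forall a b, I a -> (a <= b)%O -> J b -> J a)].

Definition idl_join I J K : set L := smallest (ideal_of I) (J `|` K).

Definition idl_neg I J : set L :=
  [set a | I a /\ forall b, J b -> (a `&` b)%O = \bot%O].

Definition simple_ideal I J : Prop :=
  ideal_of I J /\ idl_join I J (idl_neg I J) = I.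

End Ideals.

Record lba := LBA {
  lba_disp : Order.disp_t;
  lba_alg :> ctbDistrLatticeType lba_disp;
  lba_ideal : set lba_alg;
  lba_ideal_of : ideal_of [set: lba_alg] lba_ideal;
  lba_dense : forall a : lba_alg, a <> \bot%O ->
    exists b, [/\ lba_ideal b, b <> \bot%O & (b <= a)%O] }.

Record zlba := ZLBA {
  zlba_lba :> lba;
  zlba_join : forall J : set zlba_lba,
    simple_ideal (@lba_ideal zlba_lba) J -> supremums J !=set0 }.

(* The library's {tblmorphism _ -> _} only asks for preservation of \bot and   *)
(* \top, hence the explicit definition.                                       *)
Definition boolean_hom d d' (A : ctbDistrLatticeType d)
    (B : ctbDistrLatticeType d') (phi : A -> B) : Prop :=
  [/\ {morph phi : a b / (a `&` b)%O >-> (a `&` b)%O},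
      {morph phi : a b / (a `|` b)%O >-> (a `|` b)%O},
      {morph phi : a / (~` a)%O >-> (~` a)%O},
      phi \bot%O = \bot%O &
      phi \top%O = \top%O].

Definition complete_hom d d' (A : ctbDistrLatticeType d)
    (B : ctbDistrLatticeType d') (phi : A -> B) : Prop :=
  forall (S : set A) (a : A), supremums S a -> supremums (phi @` S) (phi a).

Definition zlba_morphism (A B : zlba) (phi : A -> B) : Prop :=
  boolean_hom phi /\
  forall b, @lba_ideal B b -> exists2 a, @lba_ideal A a & (b <= phi a)%O.

Definition skezlba_hom (A B : zlba) : Type :=
  {phi : A -> B | zlba_morphism phi /\ complete_hom phi}.

Program Definition skezlba_id (A : zlba) : skezlba_hom A A :=
  exist _ idfun _.
Next Obligation.
move=> A; split; last by move=> S a; rewrite image_id.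
by split => // b Ib; exists b.
Qed.

Program Definition skezlba_comp (A B C : zlba) (psi : skezlba_hom B C)
    (phi : skezlba_hom A B) : skezlba_hom A C :=
  exist _ (sval psi \o sval phi) _.
Next Obligation.
move=> A B C [psi [[[pI pU pC p0 p1] pJ] pc]] [phi [[[fI fU fC f0 f1] fJ] fc]] /=.
split; last by move=> S a /fc /pc; rewrite -image_comp.
split.
  split=> [a b|a b|a||] /=; rewrite ?(fI, fU, fC, f0, f1) //.
move=> c /pJ[b /fJ[a Ia ba] cb]; exists a => //=.
apply: (le_trans cb).
by move/meet_idPl: ba => <-; rewrite pI leIr.
Qed.

Program Definition SkeZLBA : category :=
  @Category zlba skezlba_hom skezlba_id skezlba_comp _ _ _.
Next Obligation. by move=> A B [f Hf]; exact: eq_exist. Qed.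
Next Obligation. by move=> A B [f Hf]; exact: eq_exist. Qed.
Next Obligation. by move=> A B C D h g f; exact: eq_exist. Qed.

(* Main.v *)
From HB Require Import structures.
From mathcomp Require Import all_boot all_order.
From mathcomp Require Import all_classical.
From mathcomp Require Import topology.
Require Import Defs.

(** The duality is Stone's, with compactness confined to an ideal.  A space [X]
    is sent to the Boolean algebra of its clopen sets together with the ideal of
    the compact ones, and a map to its preimage operation.  This contravariant
    functor is shown to be full, faithful and essentially surjective, which is
    enough for an equivalence ([fully_faithful_equivalent]).

    Skeletal maps correspond to complete homomorphisms because, in a space with
    a base of clopen sets, a clopen set [a] is the join of a family [S] exactly
    when [S] lies below [a] and [\bigcup S] is dense in [a]
    ([clopens_supremumsP]).  A skeletal map pulls density back
    ([clopen_preimage_complete]).  Conversely, a complete homomorphism is the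
    preimage operation of a unique map, whose value at [x] is the limit of the
    clopen sets whose image contains [x] ([dual_pointP]); it is skeletal because
    the homomorphism preserves the join [\top] of the clopen sets that are
    included in, or disjoint from, a given open set ([dual_map_skeletal]).

    For essential surjectivity, an algebra [(A, I)] is represented on the space
    of the ultrafilters of [A] that meet [I].  Density of [I] provides enough of
    them ([ultrafilter_exists]), so [A] embeds into the clopen sets; the members
    of [I] become precisely the compact ones ([compact_stoneP]).  The condition
    on simple ideals enters only here: a clopen set is the union of the simple
    ideal of the members of [I] below it, and the join of this ideal in [A]
    represents it ([stone_surjective]).  On the side of spaces the condition
    holds since the union of a simple ideal is clopen
    ([simple_ideal_clopen]). *)

Set Implicit Arguments.
Unset Strict Implicit.
Unset Printing Implicit Defensive.

Import Order.Theory.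

Local Open Scope classical_set_scope.

(** * Fully faithful, essentially surjective functors *)

Section FullyFaithful.
Variables (C D : category) (F : cat_functor C D).
Hypothesis F_full : forall (X Y : C) (g : hom (F X) (F Y)),
  exists f : hom X Y, fmap F f = g.
Hypothesis F_faithful : forall (X Y : C) (f f' : hom X Y),
  fmap F f = fmap F f' -> f = f'.
Hypothesis F_surj : forall Z : D, exists (X : C) (e : hom (F X) Z), is_iso e.

Let lift X Y (g : hom (F X) (F Y)) : hom X Y := projT1 (cid (F_full g)).

Let liftK X Y (g : hom (F X) (F Y)) : fmap F (lift g) = g.
Proof. exact: projT2 (cid (F_full g)). Qed.

Let pre (Z : D) : C := projT1 (cid (F_surj Z)).

Let counit (Z : D) : hom (F (pre Z)) Z := projT1 (cid (projT2 (cid (F_surj Z)))).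

Let counit_iso (Z : D) : is_iso (counit Z).
Proof. exact: projT2 (cid (projT2 (cid (F_surj Z)))). Qed.

Let uncounit (Z : D) : hom Z (F (pre Z)) := projT1 (cid (counit_iso Z)).

Let uncounitK Z : comp (uncounit Z) (counit Z) = idc _.
Proof. exact: (projT2 (cid (counit_iso Z))).1. Qed.

Let counitK Z : comp (counit Z) (uncounit Z) = idc _.
Proof. exact: (projT2 (cid (counit_iso Z))).2. Qed.

Let pre_map Z W (g : hom Z W) : hom (pre Z) (pre W) :=
  lift (comp (uncounit W) (comp g (counit Z))).

Let pre_map_id Z : pre_map (idc Z) = idc (pre Z).
Proof. by apply: F_faithful; rewrite liftK fmap_id comp_idl uncounitK. Qed.

Let pre_map_comp Z W V (h : hom W V) (g : hom Z W) :
  pre_map (comp h g) = comp (pre_map h) (pre_map g).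
Proof.
apply: F_faithful; rewrite fmap_comp !liftK -!compA.
by congr comp; congr comp; rewrite !compA counitK comp_idl.
Qed.

Lemma fully_faithful_equivalent : equivalent C D.
Proof.
exists F, (CatFunctor pre_map_id pre_map_comp); split.
  exists (fun X => lift (counit (F X))); split=> [X|X Y f].
    exists (lift (uncounit (F X))).
    by split; apply: F_faithful;
      rewrite fmap_comp !liftK fmap_id ?uncounitK ?counitK.
  apply: F_faithful; rewrite /= !fmap_comp !liftK.
  by rewrite [RHS]compA counitK comp_idl.
exists counit; split=> [//|Z W g] /=.
by rewrite liftK compA counitK comp_idl.
Qed.

End FullyFaithful.

(** * The Boolean algebra of clopen sets *)

Record clopens (X : topologicalType) := Clopens {
  cl_set :> set X;
  cl_clopen : clopen cl_set }.

Lemma clopens_inj (X : topologicalType) : injective (@cl_set X).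
Proof.
by case=> a ca [b cb] /= ab; subst b; congr Clopens; exact: Prop_irrelevance.
Qed.

HB.instance Definition _ (X : topologicalType) := gen_eqMixin (clopens X).
HB.instance Definition _ (X : topologicalType) := gen_choiceMixin (clopens X).

Section ClopenAlgebra.
Variable X : topologicalType.
Implicit Types a b c : clopens X.

Definition cl_meet a b := Clopens (clopenI (cl_clopen a) (cl_clopen b)).
Definition cl_join a b := Clopens (clopenU (cl_clopen a) (cl_clopen b)).
Definition cl_compl a := Clopens (clopenC (cl_set a) (cl_clopen a)).
Definition cl_bot := Clopens (@clopen0 X).
Definition cl_top := Clopens (@clopenT X).

Let le a b := cl_meet a b == a.
Let lt a b := (b != a) && le a b.

Let meetC : commutative cl_meet.
Proof. by move=> a b; apply: clopens_inj; rewrite /= setIC. Qed.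
Let joinC : commutative cl_join.
Proof. by move=> a b; apply: clopens_inj; rewrite /= setUC. Qed.
Let meetA : associative cl_meet.
Proof. by move=> a b c; apply: clopens_inj; rewrite /= setIA. Qed.
Let joinA : associative cl_join.
Proof. by move=> a b c; apply: clopens_inj; rewrite /= setUA. Qed.
Let joinKI b a : cl_meet a (cl_join a b) = a.
Proof. by apply: clopens_inj; rewrite /= setUC setKU. Qed.
Let meetKU b a : cl_join a (cl_meet a b) = a.
Proof. by apply: clopens_inj; rewrite /= setIC setKI. Qed.
Let meetUl : left_distributive cl_meet cl_join.
Proof. by move=> a b c; apply: clopens_inj; rewrite /= setIUl. Qed.
Let meetxx : idempotent_op cl_meet.
Proof. by move=> a; apply: clopens_inj; rewrite /= setIid. Qed.

HB.instance Definition _ := Order.isMeetJoinDistrLattice.Build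
  Order.default_display (clopens X) (fun a b => erefl (le a b))
  (fun a b => erefl (lt a b)) meetC joinC meetA joinA joinKI meetKU meetUl
  meetxx.

Lemma cl_leP a b : reflect (cl_set a `<=` cl_set b) (a <= b)%O.
Proof.
apply: (iffP eqP) => [/(congr1 (@cl_set X))/= <-|/setIidPl ab].
  exact: subIsetr.
exact: clopens_inj.
Qed.

Let le0x a : (cl_bot <= a)%O.
Proof. by apply/cl_leP. Qed.
Let lex1 a : (a <= cl_top)%O.
Proof. by apply/cl_leP. Qed.

HB.instance Definition _ :=
  Order.hasBottom.Build Order.default_display (clopens X) le0x.
HB.instance Definition _ :=
  Order.hasTop.Build Order.default_display (clopens X) lex1.

Let joinxC a : (a `|` cl_compl a = \top)%O.
Proof. by apply: clopens_inj; rewrite /= setUv. Qed.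
Let meetxC a : (a `&` cl_compl a = \bot)%O.
Proof. by apply: clopens_inj; rewrite /= setICr. Qed.

HB.instance Definition _ := Order.TBDistrLattice_hasComplement.Build
  Order.default_display (clopens X) joinxC meetxC.

Lemma cl_setC a : cl_set (~` a)%O = ~` cl_set a.
Proof. by []. Qed.

End ClopenAlgebra.

(** * The ZLB-algebra of a space *)

(** The only form of compactness used below: for directed open covers a single
    member suffices, so that no finite subcover has to be handled. *)
Lemma compact_directed_cover (X : topologicalType) (K : set X)
    (D : set (set X)) :
  compact K -> (forall a, D a -> open a) -> D set0 ->
  (forall a b, D a -> D b -> D (a `|` b)) ->
  (forall x, K x -> exists2 a, D a & a x) ->
  exists2 a, D a & K `<=` a.
Proof.
move=> cK oD D0 DU cov; apply: contrapT => noD.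
have [||x [Kx clx]] := cK (filter_from D (fun a => K `\` a)).
- apply: filter_from_proper => [|a Da].
    apply: filter_from_filter; first by exists set0.
    move=> a b Da Db; exists (a `|` b); first exact: DU.
    by rewrite setDUr.
  apply: contrapT => Ka0; apply: noD; exists a => // x Kx.
  by apply: contrapT => nax; apply: Ka0; exists x.
- by exists set0 => //; rewrite setD0.
have [a Da ax] := cov _ Kx.
have [||y [[_ nay] ay]] := clx (K `\` a) a.
- by exists a.
- by apply: open_nbhs_nbhs; split; [exact: oD|].
- by [].
Qed.

Section ClopenZlba.
Variable X : zlc_space.
Implicit Types (a b : clopens X) (U : set X).

Lemma compact_clopen_nbhs U x : nbhs x U ->
  exists a, [/\ compact a, cl_set a x & cl_set a `<=` U].
Proof.
move=> Ux; have [V Vx [cV _]] := zlc_locally_compact I (x := x).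
have {}Vx : nbhs x V by apply: (@filterS _ (nbhs x) _ _ _ _ Vx) => y; exact.
have [W [cW Wx] WUV] := (zlc_clopen_base X).2 x _ (filterI Ux Vx).
exists (Clopens cW); split=> //= [|y /WUV[]//].
by apply: subclosed_compact cV _ => [|y /WUV[]//]; exact: cW.2.
Qed.

Definition compact_clopens : set (clopens X) := [set a | compact a].

Lemma compact_clopens_ideal : ideal_of [set: clopens X] compact_clopens.
Proof.
split=> [//||a b|a b _ /cl_leP ab cb]; first exact: compact0.
  exact: compactU.
by apply: subclosed_compact cb ab; exact: (cl_clopen a).2.
Qed.

Lemma compact_clopens_dense a : a <> \bot%O ->
  exists b, [/\ compact_clopens b, b <> \bot%O & (b <= a)%O].
Proof.
move=> a0; have [x ax] : cl_set a !=set0.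
  by apply/set0P/eqP => a_0; apply: a0; exact: clopens_inj.
have [b [cb bx ba]] := compact_clopen_nbhs
  (open_nbhs_nbhs (conj (cl_clopen a).1 ax)).
exists b; split=> //; last exact/cl_leP.
by move=> b0; rewrite b0 in bx.
Qed.

(** Zero-dimensionality identifies joins of clopen sets with closures of unions
    whenever these joins exist. *)
Lemma clopens_supremumsP (S : set (clopens X)) a :
  supremums S a <->
  [/\ ubound S a & cl_set a `<=` closure (\bigcup_(s in S) cl_set s)].
Proof.
split=> [[ubSa lubSa]|[ubSa aS]]; split=> //.
  move=> x ax U Ux; apply: contrapT => US0.
  have [b [_ bx bU]] := compact_clopen_nbhs Ux.
  have : (a <= ~` b)%O.
    apply: lubSa => s Ss; apply/cl_leP; rewrite cl_setC => y sy by_.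
    by apply: US0; exists y; split; [exists s|exact: bU].
  by move=> /cl_leP; rewrite cl_setC => /(_ _ ax); apply.
move=> b ubSb; apply/cl_leP; apply: subset_trans aS _.
rewrite (closure_id (cl_set b)).1; last exact: (cl_clopen b).2.
by apply: closureS => y [s /ubSb/cl_leP]; exact.
Qed.

Definition clopen_lba : lba := LBA compact_clopens_ideal compact_clopens_dense.

(** If [x] lay in the closure of [\bigcup J] but not in [\bigcup J], then no
    member of [J] or of its annihilator would contain [x]; so the ideal of the
    compact clopen sets missing [x] would contain both, and be everything. *)
Lemma simple_ideal_clopen (J : set clopen_lba) :
  simple_ideal (@lba_ideal clopen_lba) J ->
  clopen (\bigcup_(s in J) cl_set s).
Proof.
move=> [[JI J0 JU Jle] JnJ]; split.
  by apply: bigcup_open => s _; exact: (cl_clopen s).1.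
move=> x clJx; apply: contrapT => nJx.
have [k [ck kx _]] := compact_clopen_nbhs (@filterT _ (nbhs x) _).
have : @lba_ideal clopen_lba k by [].
rewrite -JnJ => /(_ [set c | compact (cl_set c) /\ ~ cl_set c x]); case=> //.
split.
  split=> [c []//||a b [ca nax] [cb nbx]|a b Ia /cl_leP ab [cb nbx]].
  - by split=> //; exact: compact0.
  - by split; [exact: compactU|case].
  - by split=> // /ab.
move=> b [Jb|[Ib nJb]]; first by
  split; [exact: JI|move=> bx; apply: nJx; exists b].
split=> // bx.
have [y [[s Js sy] by_]] := clJx b (open_nbhs_nbhs (conj (cl_clopen b).1 bx)).
have := congr1 (fun c : clopens X => cl_set c y) (nJb s Js).
by rewrite /= => <-; split.
Qed.

Definition clopen_zlba : zlba.
Proof.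
exists clopen_lba => J /simple_ideal_clopen cJ; exists (Clopens cJ).
split=> [s Js|b ubJ]; first by apply/cl_leP => x sx; exists s.
by apply/cl_leP => x [s /ubJ/cl_leP]; exact.
Defined.

End ClopenZlba.

(** * The functor of clopen sets *)

Section Preimage.
Variables X Y : zlc_space.

Definition clopen_preimage (f : X -> Y) (cf : continuous f)
    (a : clopens Y) : clopens X :=
  Clopens (preimage_clopen (cl_clopen a) cf).

Lemma clopen_preimage_zlba (f : X -> Y) (cf : continuous f) :
  @zlba_morphism (clopen_zlba Y) (clopen_zlba X) (clopen_preimage cf).
Proof.
split; first by split=> [a b|a b|a||]; exact: clopens_inj.
move=> b cb.
have [|||||_ [a ca <-] ba] := compact_directed_cover
    (K := f @` cl_set b) (D := @cl_set Y @` (@compact_clopens Y)).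
- by apply: continuous_compact cb; exact: continuous_subspaceT.
- by move=> _ [a _ <-]; exact: (cl_clopen a).1.
- by exists \bot%O => //; exact: compact0.
- by move=> _ _ [a ca <-] [c cc <-]; exists (a `|` c)%O => //; exact: compactU.
- move=> y _; have [a [ca ay _]] := compact_clopen_nbhs (@filterT _ (nbhs y) _).
  by exists (cl_set a) => //; exists a.
by exists a => //; apply/cl_leP => x bx; apply: ba; exists x.
Qed.

(** Skeletality turns the density of [\bigcup S] in [a] into the density of its
    preimage in the preimage of [a], as the latter is open. *)
Lemma clopen_preimage_complete (f : X -> Y) (cf : continuous f) :
  skeletal f -> complete_hom (clopen_preimage cf).
Proof.
move=> sf S a /clopens_supremumsP[ubS aS]; apply/clopens_supremumsP; split.
  by move=> _ [s /ubS/cl_leP sa <-]; apply/cl_leP => x; exact: sa.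
move=> x fax; set V := \bigcup_(s in S) cl_set s in aS.
have oV : open V by apply: bigcup_open => s _; exact: (cl_clopen s).1.
have : closure (f @^-1` V) x.
  apply: sf => //; have [+ _] := cl_clopen (clopen_preimage cf a).
  by rewrite openE => /(_ _ fax); apply: filterS => y; exact: aS.
apply: closureS => y [s Ss sfy].
by exists (clopen_preimage cf s) => //; exists s.
Qed.

End Preimage.

Definition clopen_hom (X Y : zlc_space) (f : skezlc_hom X Y) :
    skezlba_hom (clopen_zlba Y) (clopen_zlba X) :=
  exist _ (clopen_preimage (proj2_sig f).1)
    (conj (clopen_preimage_zlba (proj2_sig f).1)
          (clopen_preimage_complete _ (proj2_sig f).2)).

Lemma clopen_hom_id (X : zlc_space) :
  clopen_hom (@idc SkeZLC X) = @idc SkeZLBA (clopen_zlba X).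
Proof. by apply: eq_exist; apply: funext => a; exact: clopens_inj. Qed.

Lemma clopen_hom_comp (X Y Z : zlc_space) (g : skezlc_hom Y Z)
    (f : skezlc_hom X Y) :
  clopen_hom (@comp SkeZLC X Y Z g f) =
  @comp SkeZLBA (clopen_zlba Z) (clopen_zlba Y) (clopen_zlba X)
    (clopen_hom f) (clopen_hom g).
Proof. by apply: eq_exist; apply: funext => a; exact: clopens_inj. Qed.

Definition clopen_functor : cat_functor SkeZLC (opposite SkeZLBA) :=
  @CatFunctor SkeZLC (opposite SkeZLBA) clopen_zlba clopen_hom
    clopen_hom_id clopen_hom_comp.

Lemma clopen_functor_faithful (X Y : zlc_space) (f g : skezlc_hom X Y) :
  clopen_hom f = clopen_hom g -> f = g.
Proof.
case: f g => [f [cf sf]] [g [cg sg]] fg; apply: eq_exist; apply: funext => x.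
apply: (@zlc_hausdorff Y) => U V Ufx Vgx.
have [a [_ afx aU]] := compact_clopen_nbhs Ufx.
exists (g x); split; last exact: nbhs_singleton Vgx.
apply: aU; move/(congr1 (fun h => cl_set (sval h a) x)): fg => /= fg.
by rewrite -[cl_set a _]fg.
Qed.

(** * Every complete morphism is induced by a skeletal map *)

Section Full.
Variables (X Y : zlc_space) (phi : clopens Y -> clopens X).
Hypothesis phi_zlba : @zlba_morphism (clopen_zlba Y) (clopen_zlba X) phi.

Lemma phi_compl (a : clopens Y) : cl_set (phi (~` a)%O) = ~` cl_set (phi a).
Proof. by have [[_ _ ->]] := phi_zlba. Qed.

(** The clopen sets [a] with [x \in phi a] form an ultrafilter; it contains a
    compact set, since a compact clopen neighborhood of [x] lies below some
    [phi a] with [a] compact; so it has a cluster point, which belongs to all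
    its members since they are closed. *)
Lemma dual_pointP (x : X) :
  exists y, forall a, cl_set a y <-> cl_set (phi a) x.
Proof.
have [[phiI phiU phiC phi0 phi1] phiD] := phi_zlba.
have [k [ck kx _]] := compact_clopen_nbhs (@filterT _ (nbhs x) _).
have [a ca /cl_leP ka] := phiD k ck.
have [||y [ay cly]] := ca (filter_from [set b | cl_set (phi b) x] (@cl_set Y)).
- apply: filter_from_proper => [|b bx].
    apply: filter_from_filter; first by exists \top%O; rewrite /= phi1.
    by move=> b c bx cx; exists (b `&` c)%O => //=; rewrite phiI.
  apply/set0P/eqP => b0; have {}b0 : b = \bot%O by exact: clopens_inj.
  by move: bx; rewrite /= b0 phi0.
- by exists a => //; exact: ka.
have phiy b : cl_set (phi b) x -> cl_set b y.
  move=> bx; rewrite (closure_id (cl_set b)).1; last exact: (cl_clopen b).2.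
  by move=> B; apply: cly; exists b.
exists y => b; split=> [by_|]; last exact: phiy.
apply: contrapT => nbx.
by have /phiy : cl_set (phi (~` b)%O) x by rewrite phi_compl.
Qed.

Definition dual_map (x : X) : Y := projT1 (cid (dual_pointP x)).

Lemma dual_mapP (a : clopens Y) : dual_map @^-1` cl_set a = cl_set (phi a).
Proof.
apply/seteqP; rewrite /dual_map; split=> x /=;
  by case: cid => y /= yP; apply yP.
Qed.

Lemma dual_map_continuous : continuous dual_map.
Proof.
move=> x U Ux; have [a [_ ax aU]] := compact_clopen_nbhs Ux.
apply: (@filterS _ (nbhs x) _ (dual_map @^-1` cl_set a)) => [y /aU//|].
by rewrite dual_mapP; apply: open_nbhs_nbhs; split;
  [exact: (cl_clopen (phi a)).1|rewrite -dual_mapP].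
Qed.

(** The clopen sets contained in [V] need not have a join; adding those disjoint
    from [V] yields a family [S] with join [\top].  The image of [S] is then
    dense, and where the map takes values in [closure V], only the members of
    [S] contained in [V] contribute to it. *)
Lemma dual_map_skeletal : complete_hom phi -> skeletal dual_map.
Proof.
move=> phi_sup V oV x Ox U Ux.
pose S := [set a : clopens Y | cl_set a `<=` V \/ cl_set a `&` V = set0].
have Ssup : supremums S \top%O.
  apply/clopens_supremumsP; split=> [a _|y _ W Wy]; first exact: lex1.
  have [[z [Wz Vz]]|WV0] := pselect (W `&` V !=set0).
    have [a [_ az aV]] := compact_clopen_nbhs (open_nbhs_nbhs (conj oV Vz)).
    by exists z; split=> //; exists a => //; left.
  have [a [_ ay aW]] := compact_clopen_nbhs Wy.
  exists y; split; last exact: nbhs_singleton.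
  exists a => //; right; rewrite -subset0 => z [/aW Wz Vz].
  by apply: WV0; exists z.
have [_ topS] := (clopens_supremumsP _ _).1 (phi_sup _ _ Ssup).
have [||z [[_ [a Sa <-] az] [Oz Uz]]] := topS x _
    ((dual_map @^-1` closure V)° `&` U).
- by have [[_ _ _ _ ->]] := phi_zlba.
- by apply: filterI => //; exact: nbhs_interior.
exists z; split=> //=; move: az; rewrite -dual_mapP /= => az.
case: Sa => [|aV0]; first exact.
have clVz : closure V (dual_map z) := interior_subset Oz.
have [y [Vy ay]] := clVz _ (open_nbhs_nbhs (conj (cl_clopen a).1 az)).
by have : (cl_set a `&` V) y by []; rewrite aV0.
Qed.

End Full.

Lemma clopen_functor_full (X Y : zlc_space)
    (phi : skezlba_hom (clopen_zlba Y) (clopen_zlba X)) :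
  exists f : skezlc_hom X Y, clopen_hom f = phi.
Proof.
case: phi => phi [phi_zlba phi_sup].
exists (exist _ (dual_map phi_zlba) (conj (@dual_map_continuous _ _ _ phi_zlba)
  (dual_map_skeletal phi_sup))).
by apply: eq_exist; apply: funext => a; apply: clopens_inj; exact: dual_mapP.
Qed.

(** * The space of bounded ultrafilters *)

(** An ultrafilter of the whole algebra that meets the ideal; through its trace
    on the ideal it is the same thing as a prime filter of the ideal. *)
Record bounded_ultrafilter (A : lba) := BoundedUltrafilter {
  ultra_mem :> A -> Prop;
  ultra_meet : forall a b, ultra_mem a -> ultra_mem b -> ultra_mem (a `&` b)%O;
  ultra_le : forall a b, (a <= b)%O -> ultra_mem a -> ultra_mem b;
  ultra_bot : ~ ultra_mem \bot%O;
  ultra_or : forall a, ultra_mem a \/ ultra_mem (~` a)%O;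
  ultra_bounded : exists2 a, lba_ideal a & ultra_mem a }.

HB.instance Definition _ (A : lba) := gen_eqMixin (bounded_ultrafilter A).
HB.instance Definition _ (A : lba) := gen_choiceMixin (bounded_ultrafilter A).

Section StoneSpace.
Variable A : lba.
Implicit Types (a b c : A) (u v : bounded_ultrafilter A).

Lemma ultra_inj u v : ultra_mem u = ultra_mem v -> u = v.
Proof.
case: u v => [u ? ? ? ? ?] [v ? ? ? ? ?] /= uv; subst v.
by congr BoundedUltrafilter; exact: Prop_irrelevance.
Qed.

Lemma ultraC u a : u (~` a)%O <-> ~ u a.
Proof.
split=> [nua ua|nua]; last by case: (ultra_or u a).
by apply: (@ultra_bot _ u); rewrite -(meetxC a); exact: ultra_meet.
Qed.

Lemma ultra_top u : u \top%O.
Proof. by have [a _ ua] := ultra_bounded u; apply: ultra_le ua; exact: lex1. Qed.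

Definition stone a : set (bounded_ultrafilter A) := [set u | ultra_mem u a].

Definition stone_open (U : set (bounded_ultrafilter A)) : Prop :=
  forall u, U u -> exists2 a, u a & stone a `<=` U.

Let stone_openT : stone_open setT.
Proof. by move=> u _; exists \top%O => //; exact: ultra_top. Qed.

Let stone_openI : setI_closed stone_open.
Proof.
move=> U V oU oV u [/oU[a ua aU] /oV[b ub bV]].
exists (a `&` b)%O; first exact: ultra_meet.
by move=> v vab; split; [apply: aU|apply: bV];
  apply: ultra_le vab; rewrite ?leIl ?leIr.
Qed.

Let stone_open_bigU (I : Type) (f : I -> set (bounded_ultrafilter A)) :
  (forall i, stone_open (f i)) -> stone_open (\bigcup_i f i).
Proof.
move=> of_ u [i _ /of_[a ua ai]]; exists a => // v /ai fiv.
by exists i.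
Qed.

HB.instance Definition _ := isOpenTopological.Build (bounded_ultrafilter A)
  stone_openT stone_openI stone_open_bigU.

Lemma open_stone a : open (stone a).
Proof. by move=> u ua; exists a. Qed.

Lemma stoneC a : stone (~` a)%O = ~` stone a.
Proof. by apply/seteqP; split=> u /ultraC. Qed.

Lemma clopen_stone a : clopen (stone a).
Proof.
split; first exact: open_stone.
by rewrite -openC -stoneC; exact: open_stone.
Qed.

Lemma nbhs_stone u a : u a -> nbhs u (stone a).
Proof. by move=> ua; apply: open_nbhs_nbhs; split=> //; exact: open_stone. Qed.

Lemma nbhs_stoneP u U : nbhs u U -> exists2 a, u a & stone a `<=` U.
Proof.
rewrite nbhsE => -[V [oV Vu] VU]; have [a ua aV] := oV u Vu.
by exists a => // v /aV /VU.
Qed.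

Lemma stone_clopen_base : clopen_base (bounded_ultrafilter A).
Proof.
split=> [U [oU _]//|u U /nbhs_stoneP[a ua aU]].
by exists (stone a) => //; split=> //; exact: clopen_stone.
Qed.

Lemma stone_hausdorff : hausdorff_space (bounded_ultrafilter A).
Proof.
move=> u v cluv; apply: ultra_inj; apply/seteqP; split=> a.
  move=> ua; apply: contrapT => /ultraC nva.
  by have [w [wa /ultraC]] := cluv _ _ (nbhs_stone ua) (nbhs_stone nva).
move=> va; apply: contrapT => /ultraC nua.
by have [w [/ultraC nwa wa]] := cluv _ _ (nbhs_stone nua) (nbhs_stone va).
Qed.

(** An ultrafilter [F] of subsets of the space induces the ultrafilter
    [[set c | F (stone c)]] of the algebra, to which it converges. *)
Lemma compact_stone a : lba_ideal a -> compact (stone a).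
Proof.
move=> Ia; rewrite compact_ultra => F UF Fa.
have FF : ProperFilter F by exact: ultra_proper.
have Fmeet b c : F (stone b) -> F (stone c) -> F (stone (b `&` c)%O).
  move=> Fb Fc; apply: filterS (filterI Fb Fc) => u [ub uc].
  exact: ultra_meet.
have Fle b c : (b <= c)%O -> F (stone b) -> F (stone c).
  by move=> bc; apply: filterS => u; exact: ultra_le.
have Fbot : ~ F (stone \bot%O).
  by move=> /filter_ex[u]; exact: ultra_bot.
have For b : F (stone b) \/ F (stone (~` b)%O).
  by rewrite stoneC; exact: in_ultra_setVsetC.
pose u := @BoundedUltrafilter A [set c | F (stone c)] Fmeet Fle Fbot For
  (ex_intro2 _ _ a Ia Fa).
exists u; split=> // U /nbhs_stoneP[b ub bU].
exact: filterS ub.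
Qed.

Lemma stone_locally_compact : locally_compact [set: bounded_ultrafilter A].
Proof.
move=> u _; have [a Ia ua] := ultra_bounded u; exists (stone a).
  by apply: filterS (nbhs_stone ua).
by split; [exact: compact_stone|exact: (clopen_stone a).2].
Qed.

(** With [b'] a nonzero member of the ideal below [b], a subset [P] of the
    algebra is called large when it contains, below any nonzero [t <= b'], all
    nonzero elements under some nonzero [t' <= t].  The large sets form a proper
    filter, and for each [c] the set of the [t] with [t <= c] or [t <= ~` c] is
    large.  Hence an ultrafilter [G] of sets that contains the large ones yields
    the ultrafilter [[set c | G [set t | t <= c]]] of the algebra. *)
Lemma ultrafilter_exists b : b <> \bot%O -> exists u, u b.
Proof.
move=> b0.
(* Working below a member [b'] of the ideal makes the ultrafilter bounded. *)
have [b' [Ib' b'0 b'b]] := lba_dense b0.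
pose pos := [set t : A | t <> \bot%O].
pose F : set_system A := [set P | forall t, pos t -> (t <= b')%O ->
  exists2 t', pos t' /\ (t' <= t)%O & forall s, pos s -> (s <= t')%O -> P s].
have FF : ProperFilter F.
  apply: Build_ProperFilter_ex => [P FP|].
    have [t [t0 _] tP] := FP _ b'0 (lexx _).
    by exists t; exact: tP.
  split=> [t t0 _|P Q FP FQ t t0 tb|P Q PQ FP t t0 tb]; first by exists t.
    have [r [r0 rt] rP] := FP t t0 tb.
    have [s [s0 sr] sQ] := FQ r r0 (le_trans rt tb).
    exists s => [|q q0 qs]; first by split=> //; exact: le_trans rt.
    by split; [apply: rP => //; exact: le_trans sr|exact: sQ].
  by have [r rt rP] := FP t t0 tb; exists r => // s s0 sr; apply: PQ; exact: rP.
have [G [UG FG]] := ultraFilterLemma FF.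
have GF : ProperFilter G by exact: ultra_proper.
have Gpos : G [set t | pos t /\ (t <= b')%O].
  apply: FG => t t0 tb; exists t => // s s0 st.
  by split=> //; exact: le_trans tb.
pose D c := [set t : A | (t <= c)%O].
have Gmeet c d : G (D c) -> G (D d) -> G (D (c `&` d)%O).
  move=> Gc Gd; apply: filterS (filterI Gc Gd) => t [tc td].
  by rewrite /D /= lexI; apply/andP.
have Gle c d : (c <= d)%O -> G (D c) -> G (D d).
  by move=> cd; apply: filterS => t tc; exact: le_trans cd.
have Gbot : ~ G (D \bot%O).
  move=> Gb; have [t [[t0 _]]] := filter_ex (filterI Gpos Gb).
  by rewrite /D /= lex0 => /eqP.
have Gor c : G (D c) \/ G (D (~` c)%O).
  have Gc : G (D c `|` D (~` c)%O).
    apply: FG => t t0 tb; have [tc|tc] := eqVneq (t `&` c)%O \bot%O.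
      exists t => // s s0 st; right; apply: le_trans st _.
      by rewrite -disj_leC; apply/eqP.
    exists (t `&` c)%O; first by split; [exact/eqP|exact: leIl].
    by move=> s s0 stc; left; apply: le_trans stc _; exact: leIr.
  have [|Gnc] := in_ultra_setVsetC (D c) UG; first by left.
  by right; apply: filterS (filterI Gc Gnc) => t [[]].
have Gb' : G (D b') by apply: filterS Gpos => t [].
exists (@BoundedUltrafilter A [set c | G (D c)] Gmeet Gle Gbot Gor
  (ex_intro2 _ _ b' Ib' Gb')).
exact: Gle Gb'.
Qed.

Lemma stone_subset a b : stone a `<=` stone b <-> (a <= b)%O.
Proof.
split=> [ab|ab u]; last exact: ultra_le.
rewrite -[b]complK -disj_leC; apply/eqP; apply: contrapT => abN0.
have [u uab] := ultrafilter_exists abN0.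
have ua : u a by apply: ultra_le uab; exact: leIl.
have /ultraC : u (~` b)%O by apply: ultra_le uab; exact: leIr.
by apply; exact: ab.
Qed.

Lemma stone_join a b : stone (a `|` b)%O = stone a `|` stone b.
Proof.
apply: setC_inj; rewrite setCU -!stoneC complU.
apply/seteqP; split=> [u uab|u [ua ub]]; last exact: ultra_meet.
by split; apply: ultra_le uab; rewrite ?leIl ?leIr.
Qed.

Lemma stone_bot : stone \bot%O = set0.
Proof. by apply/seteqP; split=> u // /ultra_bot. Qed.

(** When [stone a] is compact, it is covered by a single [stone b] with [b] in
    the ideal, and [a <= b] follows. *)
Lemma compact_stoneP a : compact (stone a) <-> lba_ideal a.
Proof.
split=> [ca|]; last exact: compact_stone.
have [_ I0 IU Ile] := lba_ideal_of A.
have [||||_ [b Ib <-] /stone_subset ab] :=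
    compact_directed_cover (D := stone @` @lba_ideal A) ca.
- by move=> _ [b _ <-]; exact: open_stone.
- by exists \bot%O => //; exact: stone_bot.
- move=> _ _ [b Ib <-] [c Ic <-]; exists (b `|` c)%O; first exact: IU.
  exact: stone_join.
- move=> u _; have [b Ib ub] := ultra_bounded u.
  by exists (stone b) => //; exists b.
exact: Ile ab Ib.
Qed.

End StoneSpace.

Definition stone_space (A : lba) : zlc_space :=
  ZLCSpace (@stone_hausdorff A) (@stone_locally_compact A)
           (@stone_clopen_base A).

(** Completeness with respect to simple ideals is what makes the Stone
    representation surjective: the [a] in the ideal with [stone a `<=` U] form a
    simple ideal when [U] is clopen, and the join of this ideal represents
    [U]. *)
Lemma stone_surjective (A : zlba) (U : clopens (stone_space A)) :
  exists a : A, stone a = cl_set U.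
Proof.
have [IT I0 IU Ile] := lba_ideal_of A.
have [oU cU] := cl_clopen U.
pose J := [set a : A | lba_ideal a /\ stone a `<=` cl_set U].
have J_ideal : ideal_of (@lba_ideal A) J.
  split=> [a []//||a b [Ia aU] [Ib bU]|a b Ia ab [Ib bU]].
  - by split=> //; rewrite stone_bot.
  - by split; [exact: IU|rewrite stone_join => u []; [exact: aU|exact: bU]].
  - by split=> //; apply: subset_trans bU; exact/stone_subset.
have negJ b : lba_ideal b -> stone b `<=` ~` cl_set U ->
    idl_neg (@lba_ideal A) J b.
  move=> Ib bU; split=> // a [Ia aU]; apply/eqP; rewrite -lex0.
  apply/stone_subset => u uba; case: (bU u); last apply: aU.
    by apply: ultra_le uba; exact: leIl.
  by apply: ultra_le uba; exact: leIr.
have [_ J0 JU _] := J_ideal.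
have local V u : open V -> V u ->
    exists b : A, [/\ lba_ideal b, ultra_mem u b & stone b `<=` V].
  move=> oV Vu; have [b ub bV] := oV u Vu; have [c Ic uc] := ultra_bounded u.
  exists (b `&` c)%O; split; [|exact: ultra_meet|].
    by apply: Ile Ic => //; exact: leIr.
  by apply: subset_trans bV; apply/stone_subset; exact: leIl.
have J_simple : simple_ideal (@lba_ideal A) J.
  split=> //; apply/seteqP; split=> [c|c Ic K [K_ideal JK]].
    by apply; split=> [|a [[]//|[]//]]; split=> // a b _; exact: Ile.
  have [_ _ KU Kle] := K_ideal.
  (* Inside the compact set [stone c], the open set [U] is covered by a single
     member [a] of [J], so [c] splits along [a]. *)
  have [||||_ [a Ja <-] ca] := compact_directed_cover (D := @stone A @` J)
      (compact_closedI (compact_stone Ic) cU).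
  - by move=> _ [b _ <-]; exact: open_stone.
  - by exists \bot%O => //; exact: stone_bot.
  - move=> _ _ [a Ja <-] [b Jb <-]; exists (a `|` b)%O; first exact: JU.
    exact: stone_join.
  - move=> u [_ Uu]; have [b [Ib ub bU]] := local _ _ oU Uu.
    by exists (stone b) => //; exists b.
  apply: (Kle _ (a `|` (c `&` ~` a))%O) => //.
    by rewrite joinIr joinxC meetx1 leUr.
  apply: KU; apply: JK; [by left|right].
  apply: negJ; first by apply: Ile Ic => //; exact: leIl.
  move=> u ucna Uu; have /ultraC : u (~` a)%O.
    by apply: ultra_le ucna; exact: leIr.
  by apply; apply: ca; split=> //; apply: ultra_le ucna; exact: leIl.
have [a [ubJa lubJa]] := zlba_join J_simple.
exists a; apply/seteqP; split=> u.
  move=> ua; apply: contrapT => nUu.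
  have [b [Ib ub bU]] := local _ _ (closed_openC cU) nUu.
  have anb : (a <= ~` b)%O.
    apply: lubJa => c Jc; have [_ /(_ c Jc) bc0] := negJ b Ib bU.
    by rewrite -disj_leC meetC bc0.
  by have /ultraC := ultra_le anb ua.
move=> Uu; have [b [Ib ub bU]] := local _ _ oU Uu.
by apply: ultra_le ub; exact: ubJa.
Qed.

(** * Order isomorphisms *)

Section OrderIsomorphism.
Variables (A B : zlba) (phi : A -> B) (psi : B -> A).
Hypotheses (phiK : cancel phi psi) (psiK : cancel psi phi).
Hypothesis phi_le : {mono phi : a b / (a <= b)%O}.

Let adjoint a b : (phi a <= b)%O = (a <= psi b)%O.
Proof. by rewrite -{1}[b]psiK phi_le. Qed.

Let coadjoint a b : (b <= phi a)%O = (psi b <= a)%O.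
Proof. by rewrite -{1}[b]psiK phi_le. Qed.

Lemma order_iso_complete : complete_hom phi.
Proof.
move=> S a [ubSa lubSa]; split=> [_ [s Ss <-]|b ubSb].
  by rewrite phi_le; exact: ubSa.
rewrite adjoint; apply: lubSa => s Ss; rewrite -adjoint.
by apply: ubSb; exists s.
Qed.

Lemma order_iso_boolean : boolean_hom phi.
Proof.
have phiI : {morph phi : a b / (a `&` b)%O >-> (a `&` b)%O}.
  move=> a b; apply: le_anti; rewrite lexI !phi_le leIl leIr /=.
  by rewrite coadjoint lexI -!coadjoint leIl leIr.
have phiU : {morph phi : a b / (a `|` b)%O >-> (a `|` b)%O}.
  move=> a b; apply: le_anti; rewrite leUx !phi_le leUl leUr !andbT.
  by rewrite adjoint leUx -!adjoint leUl leUr.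
have phi0 : phi \bot%O = \bot%O by apply/eqP; rewrite -lex0 adjoint le0x.
have phi1 : phi \top%O = \top%O by apply/eqP; rewrite -le1x coadjoint lex1.
split=> // a; apply: le_anti; rewrite -disj_leC -phiI meetCx phi0 eqxx /=.
by rewrite coadjoint -disj_leC -(can_eq phiK) phiI psiK meetCx phi0 eqxx.
Qed.

Lemma order_iso_zlba :
  (forall b, @lba_ideal B b -> @lba_ideal A (psi b)) -> zlba_morphism phi.
Proof.
move=> psiI; split; first exact: order_iso_boolean.
by move=> b Ib; exists (psi b); [exact: psiI|rewrite psiK].
Qed.

End OrderIsomorphism.

Lemma stone_representation (A : zlba) :
  exists e : skezlba_hom A (clopen_zlba (stone_space A)),
    @is_iso (opposite SkeZLBA) (clopen_zlba (stone_space A)) A e.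
Proof.
pose phi (a : A) : clopen_zlba (stone_space A) := Clopens (clopen_stone a).
have phi_surj (U : clopen_zlba (stone_space A)) : exists a, phi a = U.
  by have [a aU] := stone_surjective U; exists a; exact: clopens_inj.
have [psi psiK] := choice phi_surj.
have phi_le : {mono phi : a b / (a <= b)%O}.
  by move=> a b; apply/cl_leP/idP => /stone_subset.
have phiK : cancel phi psi.
  by move=> a; apply: le_anti; rewrite -!phi_le psiK lexx.
have psi_le : {mono psi : U V / (U <= V)%O}.
  by move=> U V; rewrite -phi_le !psiK.
have phi_zlba : zlba_morphism phi.
  apply: (order_iso_zlba phiK psiK phi_le) => U cU.
  by apply/compact_stoneP; have := congr1 (@cl_set _) (psiK U) => /= ->.
have psi_zlba : zlba_morphism psi.
  by apply: (order_iso_zlba psiK phiK psi_le) => a Ia; exact/compact_stoneP.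
have phi_sup : complete_hom phi := order_iso_complete psiK phi_le.
have psi_sup : complete_hom psi := order_iso_complete phiK psi_le.
exists (exist _ phi (conj phi_zlba phi_sup)),
  (exist _ psi (conj psi_zlba psi_sup)).
by split; apply: eq_exist; apply: funext.
Qed.

Theorem theorem2p2 : dually_equivalent SkeZLC SkeZLBA.
Proof.
apply: (@fully_faithful_equivalent _ _ clopen_functor) => [X Y phi|X Y f g|A].
- exact: clopen_functor_full.
- exact: clopen_functor_faithful.
by exists (stone_space A); exact: stone_representation.
Qed.
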